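(* Let $K$ be a real closed field, $L=K(i)$ with $i^2=-1$, and let $\sigma:L\to L$ be the complex conjugation (the $K$-automorphism with $\sigma(i)=-i$). For every $n\ge 1$ and every $M\in M_{n,n}(L)$, the set $\mathrm{Num}(M)$ is a closed and bounded $\Delta$-convex subset of $L$.
   Context: $M_{n,n}(L)$ is the set of $n\times n$ matrices over $L$. For $u,v\in L^n$ set $\langle u,v\rangle:=\sum_{i=1}^n\sigma(u_i)v_i$. The numerical range of $M\in M_{n,n}(L)$ is $\mathrm{Num}(M):=\{\langle u,Mu\rangle \mid u\in L^n,\ \langle u,u\rangle=1\}\subseteq L$. $\Delta:=\{a\sigma(a)\mid a\in L\}\subseteq K$ and $1-\Delta:=\{1-s\mid s\in\Delta\}$. A set $S\subseteq L$ is $\Delta$-convex if for all $a,b\in S$ with $a\ne b$ it contains all elements $ta+(1-t)b$ with $t\in\Delta\cap(1-\Delta)$. ''Closed'' and ''bounded'' refer to the euclidean topology on $L=K+Ki\cong K^2$ induced by the order of $K$. *)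

(* Defs.v *)
From HB Require Import structures.
From mathcomp Require Import all_boot all_order all_algebra.
From mathcomp Require Import complex.
From mathcomp Require Import all_classical topology normedtype.

Set Implicit Arguments.
Unset Strict Implicit.
Unset Printing Implicit Defensive.

Import Order.TTheory GRing.Theory Num.Theory.
Import numFieldNormedType.Exports.

Local Open Scope classical_set_scope.
Local Open Scope ring_scope.

(* Antilinear in the first argument, linear in the second. *)
Definition hform (K : rcfType) (n : nat) (u v : 'cV[K[i]]_n) : K[i] :=
  \sum_(j < n) conjc (u j 0) * v j 0.

Definition numerical_range (K : rcfType) (n : nat) (M : 'M[K[i]]_n) :
    set K[i] :=
  [set hform u (M *m u) | u in [set u : 'cV[K[i]]_n | hform u u = 1]].

(* A subset of K, regarded as a subset of K[i]. *)
Definition Delta (K : rcfType) : set K[i] :=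
  [set a * conjc a | a in [set: K[i]]].
Arguments Delta K _ : clear implicits.

Definition one_minus_Delta (K : rcfType) : set K[i] :=
  [set 1 - s | s in Delta K].
Arguments one_minus_Delta K _ : clear implicits.

Definition Delta_convex (K : rcfType) (S : set K[i]) : Prop :=
  forall a b : K[i], S a -> S b -> a <> b ->
  forall t : K[i], (Delta K `&` one_minus_Delta K) t ->
  S (t * a + (1 - t) * b).

(* [K[i]] is a [numFieldType] whose norm is the modulus (an element of
   K >= 0 seen in [K[i]]), so it carries the corresponding metric topology.
   The two facts below identify its neighborhoods and its bounded sets with
   those of the euclidean plane K^2. *)

Lemma complex_nbhsP (K : rcfType) (z : K[i]) (A : set K[i]) :
  nbhs (z : (K[i] : numFieldType)) A <->
  exists2 e : K, 0 < e &
    forall w : K[i],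
      (complex.Re w - complex.Re z) ^+ 2 +
      (complex.Im w - complex.Im z) ^+ 2 < e ^+ 2 -> A w.
Proof.
have distE (w : K[i]) (e : K) : 0 < e -> (`|z - w| < (e%:C)%C) =
    ((complex.Re w - complex.Re z) ^+ 2 +
     (complex.Im w - complex.Im z) ^+ 2 < e ^+ 2).
  move=> e0; rewrite distrC normc_def ltcR.
  case: w z => [a b] [c d] /=.
  by rewrite -{1}(gtr0_norm e0) -sqrtr_sqr ltr_sqrt // exprn_gt0.
split.
  move=> /nbhs_ballP[/= e e0 zA].
  have e_real : e = ((complex.Re e)%:C)%C.
    by case: e e0 {zA} => a b /=; rewrite ltcE /= => /andP[/eqP -> _].
  have e0' : 0 < complex.Re e by move: e0; rewrite e_real ltcR.
  exists (complex.Re e) => // w zw; apply: zA.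
  by rewrite /ball /= e_real distE.
move=> [e e0 zA]; apply/nbhs_ballP; exists (e%:C)%C => /=; first by rewrite ltcR.
by move=> w; rewrite /ball /= distE // => /zA.
Qed.

Lemma complex_boundedP (K : rcfType) (A : set K[i]) :
  bounded_set (A : set (K[i] : numFieldType)) <->
  exists r : K, forall z : K[i], A z ->
    complex.Re z ^+ 2 + complex.Im z ^+ 2 <= r ^+ 2.
Proof.
have normE (z : K[i]) (r : K) : 0 <= r -> (`|z| <= (r%:C)%C) =
    (complex.Re z ^+ 2 + complex.Im z ^+ 2 <= r ^+ 2).
  move=> r0; rewrite normc_def lecR; case: z => [a b] /=.
  by rewrite -{1}(ger0_norm r0) -sqrtr_sqr ler_sqrt // exprn_ge0.
split.
  move=> [m [mreal bnd]].
  have m1 : m < ((`|complex.Re m| + 1)%:C)%C.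
    have -> : m = ((complex.Re m)%:C)%C.
      by case: m mreal {bnd} => a b; rewrite complex_real => /eqP /= ->.
    by rewrite ltcR /= (le_lt_trans (ler_norm _)) // ltrDl ltr01.
  exists (`|complex.Re m| + 1) => z Az.
  by rewrite -normE ?addr_ge0//; exact: (bnd _ m1 z Az).
move=> [r bnd]; exists (`|r|%:C)%C; split=> [|x rx z Az].
  by apply/ger0_real; rewrite lecR.
by apply: le_trans (ltW rx); rewrite normE // real_normK ?num_real //; exact: bnd.
Qed.

(* Main.v *)
(** The Toeplitz-Hausdorff argument works over any real closed field: if a form
takes a positive value at x and a negative one at y, a suitable multiple of y
makes the cross term real, and a quadratic equation gives an isotropic vector.
The difficulty is closedness, as spheres over K are not compact. If z is not in
Num(M), then N = M - z is anisotropic, and the pencil N^* u = zeta N u has an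
eigenvector u because L is algebraically closed; the orthogonal complement of
N u is also orthogonal to u for the form of N, so by induction N becomes
diagonal in a suitable basis. A positivity condition on <v, Nv> then only has
to be tested on finitely many v. Since Num(N) is convex and misses 0, the
corresponding finitely many values lie in an open half-plane {Re(c w) > 0},
whence Re(c (w - z)) >= e > 0 for all w in Num(M). *)
Require Import Defs.
From mathcomp Require Import all_boot all_order all_algebra.
From mathcomp Require Import complex.
From mathcomp Require Import all_classical topology normedtype.
From mathcomp Require Import spectral ring lra.
Import Order.TTheory GRing.Theory Num.Theory.
Import numFieldNormedType.Exports.
Local Open Scope classical_set_scope.
Local Open Scope ring_scope.
Local Notation "x %:C" := (real_complex _ x) (format "x %:C") : ring_scope.
Local Notation Re := complex.Re.
Local Notation Im := complex.Im.

(** * Adjoints, the hermitian form and its squared norm *)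

Definition adjmx {K : rcfType} {m n : nat} (A : 'M[K[i]]_(m, n)) : 'M[K[i]]_(n, m) :=
  map_mx conjc A^T.

(** Valued in [K] rather than [K[i]], so that ordered-field reasoning applies directly. *)
Definition sqnorm {K : rcfType} {n : nat} (u : 'cV[K[i]]_n) : K :=
  \sum_j (Re (u j 0) ^+ 2 + Im (u j 0) ^+ 2).

Lemma adjmxK {K : rcfType} {m n : nat} (A : 'M[K[i]]_(m, n)) : adjmx (adjmx A) = A.
Proof. by apply/matrixP=> i j; rewrite !mxE conjcK. Qed.

Lemma adjmx_mul {K : rcfType} {m n p : nat} (A : 'M[K[i]]_(m, n)) (B : 'M[K[i]]_(n, p)) :
  adjmx (A *m B) = adjmx B *m adjmx A.
Proof. by rewrite /adjmx trmx_mul map_mxM. Qed.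

Lemma hformE {K : rcfType} {n : nat} (u v : 'cV[K[i]]_n) :
  hform u v = (adjmx u *m v) 0 0.
Proof. by rewrite mxE; apply: eq_bigr => j _; rewrite !mxE. Qed.

Lemma hform_adj {K : rcfType} {m n : nat} (A : 'M[K[i]]_(m, n)) (u : 'cV_n) (v : 'cV_m) :
  hform (A *m u) v = hform u (adjmx A *m v).
Proof. by rewrite !hformE adjmx_mul mulmxA. Qed.

Lemma hformC {K : rcfType} {n : nat} (u v : 'cV[K[i]]_n) :
  hform v u = conjc (hform u v).
Proof.
rewrite /hform rmorph_sum; apply: eq_bigr => j _.
by rewrite rmorphM /= conjcK mulrC.
Qed.

Lemma hformDr {K : rcfType} {n : nat} (u v w : 'cV[K[i]]_n) :
  hform u (v + w) = hform u v + hform u w.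
Proof. by rewrite !hformE mulmxDr mxE. Qed.

Lemma hformZr {K : rcfType} {n : nat} a (u v : 'cV[K[i]]_n) :
  hform u (a *: v) = a * hform u v.
Proof. by rewrite !hformE -scalemxAr mxE. Qed.

Lemma hformDl {K : rcfType} {n : nat} (u v w : 'cV[K[i]]_n) :
  hform (u + v) w = hform u w + hform v w.
Proof. by rewrite hformC hformDr rmorphD /= -!hformC. Qed.

Lemma hformZl {K : rcfType} {n : nat} a (u v : 'cV[K[i]]_n) :
  hform (a *: u) v = conjc a * hform u v.
Proof. by rewrite hformC hformZr rmorphM /= -!hformC. Qed.

Lemma hform0l {K : rcfType} {n : nat} (v : 'cV[K[i]]_n) : hform 0 v = 0.
Proof. by rewrite -(scale0r 0) hformZl conjc0 mul0r. Qed.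

Lemma mul_conjc {K : rcfType} (z : K[i]) :
  conjc z * z = (Re z ^+ 2 + Im z ^+ 2)%:C.
Proof. by rewrite add_Re2_Im2 sqr_normc mulrC. Qed.

Lemma modulus2_gt0 {K : rcfType} {z : K[i]} :
  z != 0 -> 0 < Re z ^+ 2 + Im z ^+ 2.
Proof.
move=> z0; rewrite lt_def addr_ge0 ?sqr_ge0 // andbT; apply: contraNneq z0 => h.
by have := mul_conjc z; rewrite h => /eqP; rewrite mulf_eq0 conjc_eq0 orbb.
Qed.

Lemma hform_sqnorm {K : rcfType} {n : nat} (u : 'cV[K[i]]_n) :
  hform u u = (sqnorm u)%:C.
Proof. by rewrite /sqnorm rmorph_sum; apply: eq_bigr => j _; exact: mul_conjc. Qed.

Lemma sqnorm_ge0 {K : rcfType} {n : nat} (u : 'cV[K[i]]_n) : 0 <= sqnorm u.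
Proof. by apply: sumr_ge0 => j _; rewrite addr_ge0 ?sqr_ge0. Qed.

Lemma sqnorm_eq0 {K : rcfType} {n : nat} (u : 'cV[K[i]]_n) :
  (sqnorm u == 0) = (u == 0).
Proof.
apply/eqP/eqP => [u0|->]; last first.
  by rewrite /sqnorm big1 // => j _; rewrite mxE /= expr0n addr0.
apply/matrixP => j k; rewrite ord1 mxE.
have /eqP := u0; rewrite psumr_eq0; last by move=> i _; rewrite addr_ge0 ?sqr_ge0.
move=> /allP /(_ j (mem_index_enum _)) /=.
rewrite paddr_eq0 ?sqr_ge0 // !sqrf_eq0 => /andP[/eqP r0 /eqP i0].
by rewrite [u j 0]complexE r0 i0 !rmorph0 mulr0 addr0.
Qed.

Lemma sqnorm_gt0 {K : rcfType} {n : nat} (u : 'cV[K[i]]_n) : (0 < sqnorm u) = (u != 0).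
Proof. by rewrite lt_def sqnorm_eq0 sqnorm_ge0 andbT. Qed.

Lemma sqnormZ {K : rcfType} {n : nat} a (u : 'cV[K[i]]_n) :
  sqnorm (a *: u) = (Re a ^+ 2 + Im a ^+ 2) * sqnorm u.
Proof.
apply: complexI; rewrite rmorphM /= -!hform_sqnorm -mul_conjc.
by rewrite hformZl hformZr mulrA.
Qed.

(** The parallelogram identity with the term of [u - v] dropped. *)
Lemma sqnormD_le {K : rcfType} {n : nat} (u v : 'cV[K[i]]_n) :
  sqnorm (u + v) <= 2 * sqnorm u + 2 * sqnorm v.
Proof.
rewrite /sqnorm !mulr_sumr -big_split /=; apply: ler_sum => j _.
rewrite !mxE; case: (u j 0) (v j 0) => [a b] [c d] /=.
have := sqr_ge0 (a - c); have := sqr_ge0 (b - d); lra.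
Qed.

(** * Bounds on the form and isotropic vectors *)

Lemma norm_hform_le {K : rcfType} {n : nat} (M : 'M[K[i]]_n) (u : 'cV_n) :
  `|hform u (M *m u)| <= (\sum_i \sum_j `|M i j|) * hform u u.
Proof.
have bnd i : `|u i 0| ^+ 2 <= hform u u.
  rewrite -add_Re2_Im2 hform_sqnorm lecR /sqnorm (bigD1 i) //= lerDl.
  by apply: sumr_ge0 => j _; rewrite addr_ge0 ?sqr_ge0.
rewrite {1}/hform mulr_suml (le_trans (ler_norm_sum _ _ _)) //.
apply: ler_sum => i _; rewrite mxE normrM normcJ mulr_suml.
rewrite (le_trans (ler_wpM2l _ (ler_norm_sum _ _ _))) // mulr_sumr.
apply: ler_sum => j _; rewrite normrM mulrCA ler_wpM2l //.
(* AM-GM: twice the product of two coordinate moduli is at most the sum of their squares, and each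
   square is at most [hform u u]. *)
have h2 : 0 <= (`|u i 0| - `|u j 0|) ^+ 2 by rewrite real_exprn_even_ge0 // realB ?normr_real.
rewrite -(ler_pM2l (ltr0n _ 2)) /=.
apply: (@le_trans _ _ (`|u i 0| ^+ 2 + `|u j 0| ^+ 2)); last first.
  by rewrite mulr_natl mulr2n lerD.
rewrite -subr_ge0 (_ : _ - _ = (`|u i 0| - `|u j 0|) ^+ 2) //.
by ring.
Qed.

(* The multiplier [w] of [y] is chosen so that the cross terms sum to a real [k];
   then [p] solves [p^2 a + p k - |w|^2 b = 0], whose discriminant is positive. *)
Lemma isotropic_of_opposite {K : rcfType} {n : nat} (N : 'M[K[i]]_n) (x y : 'cV_n) (a b : K) :
  0 < a -> 0 < b -> hform x (N *m x) = a%:C -> hform y (N *m y) = - b%:C ->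
  exists2 u, u != 0 & hform u (N *m u) = 0.
Proof.
move=> a0 b0 hx hy.
have [w w0 [k hk]] : exists2 w : K[i], w != 0 &
    exists k : K, w * hform x (N *m y) + conjc w * hform y (N *m x) = k%:C.
  (* The imaginary part of the sum of cross terms is that of [w * d], so [conjc d] works, and any
     [w] does when [d = 0]. *)
  pose d := hform x (N *m y) - conjc (hform y (N *m x)).
  have [d0|d0] := eqVneq d 0.
    exists 1; first exact: oner_neq0.
    exists (2 * Re (hform x (N *m y))).
    move: d0; rewrite /d; move: (hform x _) (hform y _) => [p q] [r s] [h1 h2].
    by simpc; apply/eqP; rewrite eq_complex /=; apply/andP; split; apply/eqP; lra.
  exists (conjc d); first by rewrite conjc_eq0.
  exists (Re (conjc d * hform x (N *m y) + d * hform y (N *m x))).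
  rewrite conjcK {d0}/d; move: (hform x _) (hform y _) => [p q] [r s].
  by simpc; apply/eqP; rewrite eq_complex /=; apply/andP; split; apply/eqP; ring.
pose e := Re w ^+ 2 + Im w ^+ 2.
have e0 : 0 < e by exact: modulus2_gt0.
pose D := k ^+ 2 + 4 * a * (e * b).
have D0 : 0 <= D by rewrite /D addr_ge0 ?sqr_ge0 // !mulr_ge0 // ltW.
pose p := (Num.sqrt D - k) / (2 * a).
have hp : p ^+ 2 * a + p * k - e * b = 0.
  have hs := sqr_sqrtr D0.
  have -> : p ^+ 2 * a + p * k - e * b = (Num.sqrt D ^+ 2 - D) / (4 * a).
    by rewrite /p /D; field; rewrite gt_eqF.
  by rewrite hs subrr mul0r.
have hyw : hform (w *: y) (N *m (w *: y)) = - (e * b)%:C.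
  by rewrite -scalemxAr hformZr hformZl mulrA (mulrC w) mul_conjc hy mulrN -rmorphM.
exists (p%:C *: x + w *: y).
  (* The form is negative at [w *: y] but nonnegative at real multiples of [x], so the combination
     cannot vanish. *)
  apply/eqP => u0; have wy : w *: y = - p%:C *: x.
    by apply/eqP; rewrite scaleNr -addr_eq0 addrC u0.
  have := hyw; rewrite wy -scalemxAr hformZr hformZl mulrA -rmorphN conjc_real hx.
  rewrite -!rmorphM -rmorphN => /complexI h.
  have : 0 < e * b by rewrite mulr_gt0.
  have : 0 <= - p * - p * a by rewrite mulrNN -expr2 mulr_ge0 ?sqr_ge0 // ltW.
  by lra.
rewrite mulmxDr !hformDr !hformDl hyw -!scalemxAr !hformZr !hformZl conjc_real hx.
transitivity ((p ^+ 2 * a + p * k - e * b)%:C); last by rewrite hp.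
rewrite expr2 !(rmorphB, rmorphD, rmorphM) /= -hk.
by ring.
Qed.

Lemma numerical_range_quotient {K : rcfType} {n : nat} (M : 'M[K[i]]_n) (u : 'cV_n) :
  u != 0 -> numerical_range M (hform u (M *m u) / (sqnorm u)%:C).
Proof.
rewrite -sqnorm_gt0 => u0.
pose r := (Num.sqrt (sqnorm u))^-1.
have r2 : r * r = (sqnorm u)^-1 by rewrite -invfM -expr2 sqr_sqrtr // ltW.
exists (r%:C *: u) => /=.
  rewrite hformZl hformZr hform_sqnorm conjc_real -!rmorphM mulrA r2.
  by rewrite mulVf ?gt_eqF.
rewrite -scalemxAr hformZr hformZl conjc_real mulrA -rmorphM r2 fmorphV.
exact: mulrC.
Qed.

Lemma hform_sub_scalar {K : rcfType} {n : nat} (M : 'M[K[i]]_n) (u : 'cV_n) (z : K[i]) :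
  hform u ((M - z%:M) *m u) = hform u (M *m u) - z * (sqnorm u)%:C.
Proof.
by rewrite mulmxBl mul_scalar_mx -scaleNr hformDr hformZr hform_sqnorm mulNr.
Qed.

(** Normalizing a nonzero vector divides the form by [sqnorm u]; membership thus becomes isotropy of
    a shifted form, without the constraint of unit length. *)
Lemma numerical_rangeP {K : rcfType} {n : nat} (M : 'M[K[i]]_n) (z : K[i]) :
  numerical_range M z <-> exists2 u, u != 0 & hform u ((M - z%:M) *m u) = 0.
Proof.
split=> [[u /= u1 <-]|[u u0]].
  exists u; last by rewrite hform_sub_scalar -hform_sqnorm u1 mulr1 subrr.
  apply/eqP => u0; move: u1; rewrite u0 hform0l => /esym /eqP.
  by rewrite oner_eq0.
rewrite hform_sub_scalar => /eqP; rewrite subr_eq0 => /eqP h.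
have := numerical_range_quotient M _ u0.
by rewrite h mulfK // (inj_eq (@complexI K) _ 0) sqnorm_eq0.
Qed.

(** * Segment convexity and open half-planes *)

Definition seg_convex {K : rcfType} (S : set K[i]) : Prop :=
  forall a b, S a -> S b -> forall t : K, 0 <= t <= 1 ->
  S (t%:C * a + (1 - t)%:C * b).

Lemma numerical_range_convex {K : rcfType} {n : nat} (M : 'M[K[i]]_n) :
  seg_convex (numerical_range M).
Proof.
move=> a b Sa Sb t /andP[t0 t1].
have [->|ab] := eqVneq a b.
  by rewrite -mulrDl -rmorphD addrC subrK mul1r.
have [->|tN0] := eqVneq t 0; first by rewrite mul0r add0r subr0 mul1r.
have [->|tN1] := eqVneq t 1; first by rewrite subrr mul0r addr0 mul1r.
have {}t0 : 0 < t by rewrite lt_def tN0.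
have {}t1 : 0 < 1 - t by rewrite subr_gt0 lt_def eq_sym tN1.
have d0 : a - b != 0 by rewrite subr_eq0.
move: Sa Sb => [x /= x1 xa] [y /= y1 yb].
set z := _ + _.
have hx : sqnorm x = 1 by apply: complexI; rewrite -hform_sqnorm.
have hy : sqnorm y = 1 by apply: complexI; rewrite -hform_sqnorm.
(* Since [a - z] is [1 - t] times [a - b] and [b - z] is [- t] times it, dividing by [a - b] makes
   both values real, of opposite signs. *)
have [||u u0 hu] := isotropic_of_opposite ((a - b)^-1 *: (M - z%:M)) x y _ _ t1 t0.
- rewrite -scalemxAl hformZr hform_sub_scalar hx mulr1 xa /z rmorphB rmorph1.
  by field.
- rewrite -scalemxAl hformZr hform_sub_scalar hy mulr1 yb /z rmorphB rmorph1.
  by field.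
apply/numerical_rangeP; exists u => //.
move: hu; rewrite -scalemxAl hformZr => /eqP; rewrite mulf_eq0 invr_eq0.
by rewrite (negbTE d0) => /eqP.
Qed.

(** Induction on the list. If the half-plane found for the tail misses the new point [m], the tail
    lies strictly on one side of the line [K m]; the half-plane bounded by that line is then tilted
    slightly to take in [m]. *)
Lemma finite_open_half_plane {K : rcfType} (S : set K[i]) (s : seq K[i]) :
  seg_convex S -> ~ S 0 -> {in s, forall z, S z} ->
  exists c : K[i], {in s, forall z : K[i], 0 < Re (c * z)}.
Proof.
move=> convS S0; elim: s => [|m s IH] sS; first by exists 0.
have Sm : S m by apply: sS; rewrite mem_head.
have {}sS : {in s, forall z, S z} by move=> z zs; apply: sS; rewrite inE zs orbT.
have [c hc] := IH sS.
have [cm|cm] := ltP 0 (Re (c * m)).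
  by exists c => z; rewrite inE => /predU1P[->//|/hc].
have m0 : m != 0 by apply/eqP => m0; rewrite m0 in Sm.
have m2 := modulus2_gt0 m0.
(* Up to a positive factor, [x z] is the signed distance from [z] to the line [K m]; the existential
   keeps it opaque. *)
have [x xE] : exists x : K[i] -> K, forall z, x z = Im (conjc m * z) by eexists.
(* Otherwise [p] would be a nonpositive multiple of [m], and [0] would lie on the
   segment from [p] to [m]. *)
have no_line p : S p -> 0 < Re (c * p) -> x p <> 0.
  move=> Sp cp xp; pose r := Re (conjc m * p) / (Re m ^+ 2 + Im m ^+ 2).
  have pE : p = r%:C * m.
    apply: (@mulfI _ (conjc m)); first by rewrite conjc_eq0.
    rewrite [LHS]complexE -xE xp rmorph0 mulr0 addr0 mulrCA [conjc m * m]mul_conjc.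
    by rewrite -rmorphM /= /r divfK // gt_eqF.
  have [r0|r0] := ltP 0 r.
    move: cp; rewrite pE mulrCA; case: (c * m) cm => g h /=.
    by rewrite mul0r subr0 pmulr_rgt0 // => /le_lt_trans h1 /h1; rewrite ltxx.
  apply: S0; have r1 : 0 < 1 - r by lra.
  suff <- : (1 - r)^-1%:C * p + (1 - (1 - r)^-1)%:C * m = 0.
    apply: convS => //; rewrite invr_ge0 ltW //= invf_le1 //; lra.
  rewrite pE mulrA -rmorphM -mulrDl -rmorphD.
  have -> : (1 - r)^-1 * r + (1 - (1 - r)^-1) = 0 by field; lra.
  by rewrite mul0r.
(* Otherwise the segment from [p] to [q] crosses the line [K m] at a point excluded by [no_line];
   [t] is the parameter of the crossing. *)
have same_side p q : p \in s -> q \in s -> x p < 0 -> 0 < x q -> False.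
  move=> ps qs xp xq; have xpq : 0 < x q - x p by lra.
  pose t := x q / (x q - x p).
  have t01 : 0 <= t <= 1.
    apply/andP; split; first by apply: divr_ge0; lra.
    by rewrite /t ler_pdivrMr //; lra.
  apply: (no_line (t%:C * p + (1 - t)%:C * q)).
  - by apply: convS => //; exact: sS.
  - rewrite mulrDr !(mulrCA c); move: (hc p ps) (hc q qs).
    case: (c * p) (c * q) => [g h] [g' h'] /= g0 g0'; rewrite !mul0r !subr0.
    case/andP: t01 => t0 t1; have [t0'|] := ltP 0 t.
      have := mulr_gt0 t0' g0; have : 0 <= (1 - t) * g' by apply: mulr_ge0; lra.
      lra.
    by move=> t0'; rewrite (_ : t = 0) ?mul0r ?subr0 ?mul1r ?add0r //; lra.
  rewrite xE mulrDr !(mulrCA (conjc m)).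
  suff: t * x p + (1 - t) * x q = 0.
    rewrite !xE; case: (conjc m * p) (conjc m * q) => [g h] [g' h'] /=.
    by rewrite !mul0r !addr0.
  by rewrite /t; field; lra.
have [sg hsg] : exists sg : K, {in s, forall z, 0 < sg * x z}.
  have [/hasP[p ps xp]|/hasPn nos] := boolP (has (fun z => x z < 0) s).
    exists (- 1) => z zs; rewrite mulN1r oppr_gt0 ltNge le_eqVlt.
    apply/negP => /orP[/eqP /esym|] h; last exact: (same_side p z).
    by apply: no_line h; [exact: sS|exact: hc].
  exists 1 => z zs; rewrite mul1r lt_def leNgt nos // andbT; apply/eqP.
  by apply: no_line; [exact: sS|exact: hc].
(* A tilt small enough for all points of [s], as a minimum over the list. The [+ 1] in [A] gives a
   nonzero divisor and strictness. *)
have [e e0 he] : exists2 e : K, 0 < e & {in s, forall z, 0 < e * Re (conjc m * z) + sg * x z}.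
  elim: (s) hsg => [|z s' IH'] h; first by exists 1.
  have [|e e0 he] := IH'; first by move=> w ws; apply: h; rewrite inE ws orbT.
  have hz := h z (mem_head _ _).
  pose A := `|Re (conjc m * z)| + 1.
  have A0 : 0 < A by rewrite ltr_wpDl.
  pose e' := Num.min e (sg * x z / A).
  have e'0 : 0 < e' by rewrite lt_min e0 divr_gt0.
  exists e' => // w; rewrite inE => /predU1P[->|ws].
    have h1 : e' * A <= sg * x z by rewrite -ler_pdivlMr // ge_min lexx orbT.
    have h2 : - Re (conjc m * z) <= `|Re (conjc m * z)| by rewrite -normrN ler_norm.
    rewrite /A in h1; nra.
  have hw := he w ws; have h0 : 0 < sg * x w by apply: h; rewrite inE ws orbT.
  have h1 : e' <= e by rewrite ge_min lexx.
  have [?|?] := leP 0 (Re (conjc m * w)); first by rewrite ltr_wpDl // mulr_ge0 // ltW.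
  nra.
(* Turn [conjc m] by almost a right angle, towards the side containing [s]. *)
exists ((e -i* sg)%C * conjc m) => z; rewrite inE -mulrA => /predU1P[->|zs].
  by rewrite mul_conjc /= mulr0 subr0 mulr_gt0.
have := he z zs; rewrite xE; case: (conjc m * z) => g h /=.
by rewrite mulNr opprK.
Qed.

(** * Diagonalization of anisotropic forms and uniform positivity *)

Lemma Re_real_mulDl {K : rcfType} (r : K) (z w : K[i]) :
  Re (r%:C * z + w) = r * Re z + Re w.
Proof. by case: z w => [a b] [c d] /=; rewrite mul0r subr0. Qed.

Lemma sqnorm_mulmx_le {K : rcfType} {m n : nat} (A : 'M[K[i]]_(m, n)) :
  exists2 C : K, 0 < C & forall u, sqnorm (A *m u) <= C * sqnorm u.
Proof.
pose B := \sum_i \sum_j `|(adjmx A *m A) i j|.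
have B0 : 0 <= B by apply: sumr_ge0 => k _; apply: sumr_ge0 => l _.
have BE : B = (Re B)%:C by rewrite RRe_real // ger0_real.
have ReB : 0 <= Re B by rewrite -ler0c -BE.
exists (Re B + 1); first by rewrite ltr_wpDl.
move=> u; have := norm_hform_le (adjmx A *m A) u.
rewrite -mulmxA -hform_adj !hform_sqnorm ger0_norm ?ler0c ?sqnorm_ge0 //.
rewrite -/B BE -rmorphM lecR => /le_trans; apply.
by rewrite ler_wpM2r ?sqnorm_ge0 // lerDl.
Qed.

(** Anisotropy makes [M] invertible, which turns the pencil into an ordinary eigenvalue problem; the
    transposes are there because [eigenvalue] concerns row vectors. *)
Lemma anisotropic_eigenvector {K : rcfType} {n : nat} (M : 'M[K[i]]_n) :
  (0 < n)%N -> (forall u, hform u (M *m u) = 0 -> u = 0) ->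
  exists2 u : 'cV_n, u != 0 & exists z, adjmx M *m u = z *: (M *m u).
Proof.
move=> n0 anis.
have MU : M^T \in unitmx.
  rewrite -row_free_unit -kermx_eq0; apply/eqP/row_matrixP => k; rewrite row0.
  set v := row k _; have vM : v *m M^T = 0 by rewrite -row_mul mulmx_ker row0.
  have : v^T = 0.
    apply: anis; have -> : M *m v^T = 0 by rewrite -(trmxK M) -trmx_mul vM trmx0.
    by rewrite hformC hform0l conjc0.
  by move/(congr1 trmx); rewrite trmxK trmx0.
have [z /eigenvalueP[v vE v0]] := eigenvalue_closed ((adjmx M)^T *m invmx M^T) n0.
exists v^T; first by rewrite trmx_eq0.
exists z; apply: trmx_inj; rewrite linearZ /= !trmx_mul trmxK.
by rewrite scalemxAl -vE -!mulmxA mulVmx // mulmx1.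
Qed.

(** The test vectors form a basis diagonalizing the form. They are chosen before [c], which can
    therefore be picked afterwards from their values; the uniform [e] stands in for compactness. *)
Lemma anisotropic_positivity {K : rcfType} {n : nat} (M : 'M[K[i]]_n) :
  (forall u, hform u (M *m u) = 0 -> u = 0) ->
  exists2 s : seq 'cV[K[i]]_n, {in s, forall v, v != 0} &
    forall c, {in s, forall v, 0 < Re (c * hform v (M *m v))} ->
    exists2 e : K, 0 < e & forall u, e * sqnorm u <= Re (c * hform u (M *m u)).
Proof.
have [k] := ubnP n; elim: k n M => // k IH n M nk anis.
have [n0|n0] := posnP n.
  exists [::] => // c _; exists 1 => // u.
  have -> : u = 0 by apply/matrixP => i j; move: (ltn_ord i); rewrite {2}n0.
  by rewrite hform0l mulr0 mul1r /= (eqP (_ : sqnorm 0 == 0)) ?sqnorm_eq0.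
have [u u0 [z uz]] := anisotropic_eigenvector M n0 anis.
set v := M *m u in uz.
set m := hform u v.
have m0 : m != 0 by apply: contraNneq u0 => /anis ->.
have v0 : v != 0.
  by apply: contraNneq m0 => v0; rewrite /m v0 hformC hform0l conjc0.
pose r := \rank (kermx v).
(* The columns of [P] are a basis of the orthogonal complement of [v]; [kermx] gives rows, hence the
   adjoint. *)
pose P : 'M_(n, r) := adjmx (row_base (kermx v)).
have rk : (r < k)%N.
  rewrite /r mxrank_ker -ltnS (leq_trans _ nk) // ltnS ltn_subLR ?rank_leq_row //.
  by rewrite -[ltnLHS]add0n ltn_add2r lt0n mxrank_eq0.
have Pv w : hform (P *m w) v = 0.
  rewrite hform_adj adjmxK; have -> : row_base (kermx v) *m v = 0.
    by apply/eqP; rewrite -sub_kermx eq_row_base.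
  by rewrite hformC hform0l conjc0.
(* The eigenvector equation moves [M] onto [u] in the second cross term, reducing it to the
   first. *)
have vP w : hform (P *m w) (M *m u) = 0 /\ hform u (M *m (P *m w)) = 0.
  split; first exact: Pv.
  by rewrite hformC hform_adj uz hformZr Pv mulr0 conjc0.
have Pinj w : P *m w = 0 -> w = 0.
  move=> /(congr1 adjmx); rewrite adjmx_mul adjmxK => h.
  have : adjmx w *m row_base (kermx v) = 0 *m row_base (kermx v).
    by rewrite h mul0mx; apply/matrixP => i j; rewrite !mxE conjc0.
  move/(row_free_inj (row_base_free _))/(congr1 adjmx); rewrite adjmxK => ->.
  by apply/matrixP => i j; rewrite !mxE conjc0.
have decomp y : exists a, exists w, y = a *: u + P *m w.
  (* The coefficient for which [y - a *: u] is orthogonal to [v]. *)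
  pose a := conjc (hform y v / m).
  have : (adjmx (y - a *: u) <= row_base (kermx v))%MS.
    rewrite eq_row_base sub_kermx; apply/eqP/matrixP => i j.
    rewrite !ord1 [RHS]mxE -hformE -scaleNr hformDl hformZl rmorphN /= conjcK -/m.
    by rewrite mulNr divfK // subrr.
  move=> /submxP[D DE]; exists a, (adjmx D).
  by rewrite -adjmx_mul -DE adjmxK addrC subrK.
have [|s s0 hs] := IH r (adjmx P *m M *m P) rk.
  by move=> w; rewrite -!mulmxA -hform_adj => /anis /Pinj.
exists (u :: [seq P *m w | w <- s]).
  move=> w; rewrite inE => /predU1P[->//|/mapP[w' /s0 w'0 ->]].
  by apply: contraNneq w'0 => /Pinj ->.
move=> c pos.
have cm : 0 < Re (c * m) by apply: pos; rewrite mem_head.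
have [|e e0 he] := hs c.
  move=> w ws; rewrite -!mulmxA -hform_adj; apply: pos.
  by rewrite inE map_f ?orbT.
have [C C0 hC] := sqnorm_mulmx_le P.
have su : 0 < sqnorm u by rewrite sqnorm_gt0.
(* The factors 2 absorb those of [sqnormD_le], and [C] bounds the distortion by [P]. *)
pose e' := Num.min (Re (c * m) / (2 * sqnorm u)) (e / (2 * C)).
have e'0 : 0 < e' by rewrite lt_min !divr_gt0 ?mulr_gt0.
exists e' => // y; have [a [w ->]] := decomp y.
have e1 : e' * (2 * sqnorm u) <= Re (c * m).
  by rewrite -ler_pdivlMr ?mulr_gt0 // ge_min lexx.
have e2 : e' * (2 * C) <= e by rewrite -ler_pdivlMr ?mulr_gt0 // ge_min lexx orbT.
have [vP1 vP2] := vP w.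
rewrite mulmxDr !hformDr !hformDl -!scalemxAr !hformZr !hformZl vP1 vP2 !mulr0 addr0 add0r.
rewrite mulrA [a * _]mulrC mul_conjc -/v -/m hform_adj mulmxA mulmxA.
have h1 := he w; have h2 := sqnormD_le (a *: u) (P *m w); have h3 := hC w.
rewrite sqnormZ in h2.
set A := Re a ^+ 2 + Im a ^+ 2 in h2 *.
have A0 : 0 <= A by rewrite addr_ge0 ?sqr_ge0.
have w0 := sqnorm_ge0 w.
rewrite mulrDr mulrCA Re_real_mulDl.
apply: (@le_trans _ _ (e' * (2 * (A * sqnorm u) + 2 * (C * sqnorm w)))).
  by apply: ler_wpM2l; [exact: ltW|lra].
have h4 := ler_wpM2r A0 e1; have h5 := ler_wpM2r w0 e2; lra.
Qed.

(** * Closedness by separation, boundedness, and Delta-convexity *)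

Theorem theorem2 (K : rcfType) (n : nat) (hn : (1 <= n)%N) (M : 'M[K[i]]_n) :
  [/\ closed (numerical_range M : set (K[i] : numFieldType)),
      bounded_set (numerical_range M : set (K[i] : numFieldType))
    & Delta_convex (numerical_range M)].
Proof.
split.
- move=> z clz; apply: contrapT => Nz.
  pose N := M - z%:M.
  have anis u : hform u (N *m u) = 0 -> u = 0.
    by move=> Nu; apply: contrapT => /eqP u0; apply/Nz/numerical_rangeP; exists u.
  have [s s0 hs] := anisotropic_positivity N anis.
  pose vals := [seq hform u (N *m u) / (sqnorm u)%:C | u <- s].
  have N0 : ~ numerical_range N 0.
    by move=> /numerical_rangeP[u u0]; rewrite raddf0 subr0 => /anis /eqP; apply/negP.
  have [|c hc] := finite_open_half_plane _ vals (numerical_range_convex N) N0.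
    by move=> w /mapP[u /s0 u0 ->]; exact: numerical_range_quotient.
  have [|e e0 he] := hs c.
    move=> u us; have u1 : 0 < sqnorm u by rewrite sqnorm_gt0 s0.
    have := hc _ (map_f _ us); rewrite mulrA -fmorphV.
    case: (c * _) => g h /=; rewrite mulr0 subr0.
    by rewrite pmulr_lgt0 // invr_gt0.
  (* If both coordinates of [w - z] are below [e / L] in absolute value, then
     [Re (c * (w - z)) < e]; the [+ 1] keeps [L] positive. *)
  pose L := `|Re c| + `|Im c| + 1.
  have L0 : 0 < L by rewrite ltr_wpDl ?addr_ge0.
  have [|w [[u /= u1 <-]]] := clz [set w | Re (c * (w - z)) < e].
    apply/complex_nbhsP; exists (e / L); first by rewrite divr_gt0.
    move=> w; case: (w) (z) => [p q] [p' q'] /= h.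
    have b (r : K) : r ^+ 2 < (e / L) ^+ 2 -> `|r| < e / L.
      move=> h2; rewrite -ltr_sqr ?nnegrE ?divr_ge0 ?(ltW e0) ?(ltW L0) //.
      by rewrite real_normK ?num_real.
    have hp : `|p - p'| < e / L by apply: b; have := sqr_ge0 (q - q'); lra.
    have hq : `|q - q'| < e / L by apply: b; have := sqr_ge0 (p - p'); lra.
    have eL : e = L * (e / L) by rewrite mulrCA divff ?mulr1 // gt_eqF.
    have k0 : 0 < e / L by rewrite divr_gt0.
    rewrite eL; move: (e / L) k0 hp hq => k k0 hp hq.
    rewrite /L; case: c {hc he L L0 eL h b} => d f /=.
    have hd : d * (p - p') <= `|d| * k.
      by rewrite (le_trans (ler_norm _)) // normrM ler_wpM2l // ltW.
    have hf : - (f * (q - q')) <= `|f| * k.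
      by rewrite (le_trans (ler_norm _)) // normrN normrM ler_wpM2l // ltW.
    lra.
  rewrite ltNge; case/negP.
  have hu : sqnorm u = 1 by apply: complexI; rewrite -hform_sqnorm.
  by have := he u; rewrite hform_sub_scalar hu rmorph1 !mulr1.
- exists (\sum_i \sum_j `|M i j|); split.
    by apply: ger0_real; apply: sumr_ge0 => k _; apply: sumr_ge0.
  move=> x /ltW Bx w [u /= u1 <-]; apply: le_trans Bx.
  by have := norm_hform_le M u; rewrite u1 mulr1.
- move=> a b Sa Sb _ t [[x _ tE] [_ [y _ <-] tE']].
  (* Both [t] and [1 - t] are squared moduli, so [t] is real and lies between 0 and 1. *)
  have xE : t = (Re x ^+ 2 + Im x ^+ 2)%:C by rewrite -mul_conjc mulrC.
  have yE : 1 - t = (Re y ^+ 2 + Im y ^+ 2)%:C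
    by rewrite -mul_conjc mulrC -tE' opprB addrC subrK.
  have := numerical_range_convex M _ _ Sa Sb (Re x ^+ 2 + Im x ^+ 2).
  rewrite rmorphB rmorph1 /= -xE; apply.
  rewrite addr_ge0 ?sqr_ge0 //= -lecR -xE rmorph1 -subr_ge0 yE ler0c.
  by rewrite addr_ge0 ?sqr_ge0.
Qed.
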